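(* Let $\boldsymbol{a}\in\mathbb{Z}^\omega$ be a thick sequence, and let $H$ be a subgroup of $\mathbb{T}$. Then the following hold: (i) if $H$ is $F_\sigma$ then $\mathcal{J}_{H,\boldsymbol{a}}$ is an $F_\sigma$ ideal (and, hence, a $P^+$-ideal); (ii) if $H$ is analytic then $\mathcal{J}_{H,\boldsymbol{a}}$ is an analytic ideal; (iii) $H$ is finite if and only if $\mathcal{I}_{H,\boldsymbol{a}}$ is a $P$-ideal; (iv) if $\boldsymbol{a}$ is finite-to-one, then $H$ is finite if and only if $\mathcal{J}_{H,\boldsymbol{a}}$ is a $P$-ideal.
   Context: $\omega=\{0,1,2,\dots\}$; $\mathbb{T}=\mathbb{R}/\mathbb{Z}$; $\|x\|:=\min\{|x-z|:z\in\mathbb{Z}\}$. A sequence $\boldsymbol{a}=(a_n:n\in\omega)\in\mathbb{Z}^\omega$ is thick if $\mathrm{ran}(\boldsymbol{a}):=\{a_n:n\in\omega\}$ contains arbitrarily large (arbitrarily long finite) intervals of integers. For $\alpha\in\mathbb{T}$ and $\varepsilon>0$ put $N_{\boldsymbol{a}}(\alpha,\varepsilon):=\{n\in\mathrm{ran}(\boldsymbol{a}):\|n\alpha\|\ge\varepsilon\}$. For a subgroup $H$ of $\mathbb{T}$, $\mathcal{I}_{H,\boldsymbol{a}}$ is the ideal on $\mathrm{ran}(\boldsymbol{a})$ generated by the sets $N_{\boldsymbol{a}}(\alpha,\varepsilon)$ with $\alpha\in H$, $\varepsilon>0$, i.e. the family of all $S\subseteq\mathrm{ran}(\boldsymbol{a})$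 contained in the union of a finite subset of $\mathrm{ran}(\boldsymbol{a})$ and finitely many such sets $N_{\boldsymbol{a}}(\alpha,\varepsilon)$. Then $\mathcal{J}_{H,\boldsymbol{a}}:=\{S\subseteq\omega:\{a_n:n\in S\}\in\mathcal{I}_{H,\boldsymbol{a}}\}$, an ideal on $\omega$. Both are proper ideals containing all finite sets. For a countably infinite set $X$, $\mathcal{P}(X)$ is identified with the Cantor space $2^X$, and topological complexity of ideals refers to this topology. An ideal $\mathcal{I}$ on $X$ is a $P$-ideal if for every sequence $(S_n:n\in\omega)$ in $\mathcal{I}$ there is $S\in\mathcal{I}$ with $S_n\setminus S$ finite for all $n$. With $\mathcal{I}^+:=\mathcal{P}(X)\setminus\mathcal{I}$, $\mathcal{I}$ is a $P^+$-ideal if for every decreasing sequence $(A_n:n\in\omega)$ in $\mathcal{I}^+$ there is $A\in\mathcal{I}^+$ such that $A\setminus A_n$ is finite for all $n\in\omega$. *)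

(* Defs.v *)
From HB Require Import structures.
From mathcomp Require Import all_boot all_order all_algebra.
From mathcomp Require Import all_classical all_reals all_analysis.
From mathcomp Require Import borel_hierarchy.

Set Implicit Arguments.
Unset Strict Implicit.
Unset Printing Implicit Defensive.

Import Order.TTheory GRing.Theory Num.Theory.
Import numFieldNormedType.Exports.

Local Open Scope classical_set_scope.
Local Open Scope ring_scope.

Section Circle.
Variable R : realType.

(* [Num.int_num_subdef] is the predicate underlying [x \is a Num.int]. *)
Definition integers : zmodClosed R :=
  GRing.ZmodClosed.clone R Num.int_num_subdef _.

Definition circle : Type :=
  quotient_topology (Quotient.quot integers).

HB.instance Definition _ := generic_quotient.Quotient.on circle.
HB.instance Definition _ := Topological.on circle.
HB.instance Definition _ :=
  GRing.Zmodule.copy circle (Quotient.quot integers).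

(* The infimum is attained and independent of the representative of [x]. *)
Definition circle_norm (x : circle) : R :=
  inf [set `| repr x - z%:~R | | z in [set: int]].

Definition is_subgroup (H : set circle) : Prop :=
  GRing.zmod_closed (mem H).

End Circle.

Definition baire_space : topologicalType :=
  prod_topology (fun _ : nat => nat).

(* Intended for Polish [T]. *)
Definition analytic (T : topologicalType) (A : set T) : Prop :=
  A = set0 \/ exists2 f : baire_space -> T, continuous f & range f = A.

(* The identification of P(omega) with the Cantor space, used to speak of the
   topological complexity of a family of subsets of omega. *)
Definition in_cantor (J : set (set nat)) : set cantor_space :=
  [set x | J [set n | x n]].

Section Ideals.
Variable U : Type.
Implicit Types (X : set U) (I : set (set U)).

(* Ideals are proper and contain the finite sets. *)
Definition is_ideal X I : Prop :=
  [/\ forall S, I S -> S `<=` X,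
      forall S, S `<=` X -> finite_set S -> I S,
      forall S S', S `<=` S' -> I S' -> I S,
      forall S S', I S -> I S' -> I (S `|` S')
    & ~ I X].

Definition P_ideal X I : Prop :=
  is_ideal X I /\
  forall S_ : nat -> set U, (forall n, I (S_ n)) ->
    exists2 S, I S & forall n, finite_set (S_ n `\` S).

Definition positive X I : set (set U) := [set A | A `<=` X /\ ~ I A].

Definition Pplus_ideal X I : Prop :=
  is_ideal X I /\
  forall A_ : nat -> set U,
    (forall n, positive X I (A_ n)) -> (forall n, A_ n.+1 `<=` A_ n) ->
    exists2 A, positive X I A & forall n, finite_set (A `\` A_ n).

End Ideals.

Definition thick (a : nat -> int) : Prop :=
  forall L : nat, exists m : int,
    forall i : nat, (i < L)%N -> range a (m + i%:Z).

Definition finite_to_one (a : nat -> int) : Prop :=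
  forall k : int, finite_set (a @^-1` [set k]).

Section IdealsOfSubgroup.
Variable R : realType.
Variables (H : set (circle R)) (a : nat -> int).

Definition Nset (alpha : circle R) (eps : R) : set int :=
  [set n | range a n /\ eps <= circle_norm (alpha *~ n)].

(* A pair in [s] stands for (alpha, eps). *)
Definition idealI : set (set int) :=
  [set S | S `<=` range a /\
    exists F : set int, exists s : seq (circle R * R),
      [/\ finite_set F, F `<=` range a,
          forall p, p \in s -> H p.1 /\ 0 < p.2
        & S `<=` F `|` \bigcup_(p in [set` s]) Nset p.1 p.2]].

Definition idealJ : set (set nat) := [set S | idealI (a @` S)].

End IdealsOfSubgroup.

(* Main.v *)
Require Import Defs.
From HB Require Import structures.
From mathcomp Require Import all_boot all_order all_algebra.
From mathcomp Require Import all_classical all_reals all_analysis.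
From mathcomp Require Import borel_hierarchy.
From mathcomp Require Import zify lra.

Set Implicit Arguments.
Unset Strict Implicit.
Unset Printing Implicit Defensive.

Import Order.TTheory GRing.Theory Num.Theory.
Import numFieldNormedType.Exports.

Local Open Scope classical_set_scope.
Local Open Scope ring_scope.

(** Bohr sets, the sets of integers [n] at which finitely many characters
[u *~ n] of the integers are small, govern both ideals: a subset of the range of
[a] belongs to [idealI H a] exactly when it avoids, up to a finite set, the trace
of a Bohr set given by characters in [H]. Bohr sets are syndetic
([bohr_set_syndetic]), so each translate of a Bohr set meets the range of a thick
sequence outside any finite set ([thick_meets_bohr_set]). Hence the ideals are
proper, and what holds on the trace of a Bohr set spreads to all integers in a
smaller Bohr set ([small_on_thick_bohr_set]).

If [H] is finite, the members of the range that do not annihilate [H] form an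
almost largest member of the ideal ([finite_subgroup_almost_max]), and an ideal
with such a member is a P-ideal. If [H] is infinite, choose infinitely many
distinct [v j] in [H]. If one member of the ideal almost contained every
[Nset a (v j) 32^-1], then all [v j] would be small on one Bohr set; but a family
of characters uniformly small on a Bohr set is finite
([finite_of_small_on_bohr_set]), because two members of the family that are close
at finitely many test integers have a difference all of whose multiples are
small, and the circle has no small subgroups ([circle_no_small_subgroup]).

For the complexity, [in_cantor (idealJ H a)] is the union over [k] of the
families [covered_subsets a k H] of subsets that are covered by means of [k]
characters from [H], with exceptional set in [[-k, k]] and [eps] equal to
[1/(k+1)]. If the characters are restricted to a closed subset of the circle,
the family is the projection along a compact space of a closed relation, hence
closed ([covered_subsets_closed]); writing [H] as a countable union of closed
sets makes the ideal an F-sigma set. The closed pieces are hereditary, so a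
positive set has a finite part outside any given piece, and a union of such
finite parts, taken along a decreasing sequence, witnesses the P+ property
([Pplus_of_closed_hereditary]). If [H] is a continuous image of the Baire space,
the covers are coded by points of the Baire space, and the closed conditions on
norms are replaced by clopen ones by means of [seq_space_separation], so that
the coding is continuous ([analytic_idealJ]). *)

(** * The norm on the circle *)

Section CircleNorm.
Variable R : realType.
Implicit Types (x y : R) (u v w : circle R).

Definition proj_circle (x : R) : circle R := (\pi_(circle R) x)%qT.

Lemma proj_circle_repr u : proj_circle (repr u) = u.
Proof. exact: reprK. Qed.

Lemma proj_circleB x y : proj_circle (x - y) = proj_circle x - proj_circle y.
Proof. exact: (raddfB (\pi_(Quotient.quot (integers R)))%qT). Qed.

Lemma proj_circleD x y : proj_circle (x + y) = proj_circle x + proj_circle y.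
Proof. exact: (raddfD (\pi_(Quotient.quot (integers R)))%qT). Qed.

Lemma proj_circle0 : proj_circle 0 = 0.
Proof. exact: (raddf0 (\pi_(Quotient.quot (integers R)))%qT). Qed.

Lemma proj_circleMz x (n : int) : proj_circle (x *~ n) = proj_circle x *~ n.
Proof. exact: (raddfMz (\pi_(Quotient.quot (integers R)))%qT). Qed.

Lemma proj_circle_eqP x y :
  proj_circle x = proj_circle y <-> exists z : int, x = y + z%:~R.
Proof.
have modZ : (x - y \is a Num.int) =
    (\pi_(Quotient.quot (integers R)) x == \pi_(Quotient.quot (integers R)) y)%qT.
  exact: (Quotient.idealrBE (integers R) x y).
split=> [E|[z E]].
  have : x - y \is a Num.int by rewrite modZ; apply/eqP; exact: E.
  by move=> /intrP[z Ez]; exists z; rewrite -Ez addrC subrK.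
have : x - y \is a Num.int by rewrite E addrAC subrr add0r intr_int.
by rewrite modZ => /eqP.
Qed.

Lemma continuous_proj_circle : continuous proj_circle.
Proof. exact: pi_continuous. Qed.

Lemma circle_norm_proj_le x : circle_norm (proj_circle x) <= `|x|.
Proof.
have /proj_circle_eqP[z E] : proj_circle (repr (proj_circle x)) = proj_circle x.
  by rewrite proj_circle_repr.
apply: ge_inf; first by exists 0 => _ [t _ <-].
by exists z => //; rewrite E addrK.
Qed.

(** The infimum is attained at the fractional part [x] of a representative or at
[x - 1], whichever is closer to [0]. *)
Lemma circle_norm_lift u : exists2 x, proj_circle x = u & circle_norm u = `|x|.
Proof.
pose x := repr u - (Num.floor (repr u))%:~R.
have xu : proj_circle x = u.
  rewrite -[RHS]proj_circle_repr; apply/proj_circle_eqP.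
  by exists (- Num.floor (repr u)); rewrite mulrNz.
have [x0 x1] : 0 <= x /\ x < 1.
  have := floor_itv (repr u); rewrite /x intrD; lra.
have lb y : proj_circle y = u -> Num.min x (1 - x) <= `|y|.
  rewrite -xu => /proj_circle_eqP[z ->].
  rewrite ge_min; case: (leP 0 z) => z0.
    apply/orP; left; have : 0 <= z%:~R :> R by rewrite ler0z.
    by move=> ?; rewrite ger0_norm; lra.
  apply/orP; right; have : z%:~R <= -1 :> R.
    by rewrite -[-1]/((-1)%:~R) ler_int; lia.
  by move=> ?; rewrite ler0_norm; lra.
have key y : proj_circle y = u -> `|y| = Num.min x (1 - x) ->
    circle_norm u = `|y|.
  move=> yu ym; apply/eqP; rewrite eq_le -{1}yu circle_norm_proj_le /=.
  apply: lb_le_inf; first by exists `|repr u - 0%:~R|; exists 0.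
  move=> _ [z _ <-]; rewrite ym; apply: lb.
  rewrite -[RHS]proj_circle_repr; apply/proj_circle_eqP.
  by exists (- z); rewrite mulrNz.
case: (leP x (1 - x)) => xx.
  by exists x => //; apply: key => //; rewrite ger0_norm// min_l.
have x1u : proj_circle (x - 1) = u.
  by rewrite -xu; apply/proj_circle_eqP; exists (-1).
exists (x - 1) => //; apply: key => //; rewrite ler0_norm; last by lra.
by rewrite min_r; lra.
Qed.

Lemma circle_norm_ge0 u : 0 <= circle_norm u.
Proof. by have [x _ ->] := circle_norm_lift u. Qed.

Lemma circle_normD u v : circle_norm (u + v) <= circle_norm u + circle_norm v.
Proof.
have [x <- ->] := circle_norm_lift u; have [y <- ->] := circle_norm_lift v.
by rewrite -proj_circleD (le_trans (circle_norm_proj_le _))// ler_normD.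
Qed.

Lemma circle_normN u : circle_norm (- u) = circle_norm u.
Proof.
have le w : circle_norm (- w) <= circle_norm w.
  have [x <- ->] := circle_norm_lift w.
  by rewrite -[- _]sub0r -proj_circle0 -proj_circleB sub0r
    (le_trans (circle_norm_proj_le _))// normrN.
by apply/eqP; rewrite eq_le le -{1}[u]opprK le.
Qed.

Lemma circle_normB u v : circle_norm (u - v) <= circle_norm u + circle_norm v.
Proof. by rewrite -[circle_norm v]circle_normN circle_normD. Qed.

Lemma circle_norm_eq0 u : circle_norm u = 0 -> u = 0.
Proof.
by have [x <- ->] := circle_norm_lift u => /normr0_eq0 ->; rewrite proj_circle0.
Qed.

Lemma circle_norm_proj x : `|x| <= 2^-1 -> circle_norm (proj_circle x) = `|x|.
Proof.
move=> xh; apply/eqP; rewrite eq_le circle_norm_proj_le /=.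
have [y /proj_circle_eqP[z yE] ->] := circle_norm_lift (proj_circle x).
have := ler_norm x; have := ler_norm (- x); rewrite normrN => x1 x2.
have := ler_norm y; have := ler_norm (- y); rewrite normrN => y1 y2.
case: (ltgtP z 0) => z0.
- have : z%:~R <= -1 :> R by rewrite -[-1]/((-1)%:~R) ler_int; lia.
  by lra.
- have : 1 <= z%:~R :> R by rewrite -[1]/(1%:~R) ler_int; lia.
  by lra.
- by rewrite yE z0 addr0.
Qed.

(** The circle has no small subgroups: doubling an element of norm below [1/4]
doubles its norm, so some multiple by a power of two leaves that range unless
the element is [0]. *)
Lemma circle_no_small_subgroup u :
  (forall n : int, circle_norm (u *~ n) < 4^-1) -> u = 0.
Proof.
move=> small; apply: circle_norm_eq0.
have le4 : 4^-1 <= 1 :> R by lra.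
have dbl v : circle_norm v < 4^-1 -> circle_norm (v *+ 2) = circle_norm v *+ 2.
  have [x <- xE] := circle_norm_lift v; rewrite xE => x4.
  rewrite [in LHS]mulr2n -proj_circleD circle_norm_proj -mulr2n normrMn//.
  by move: x4; rewrite mulr2n; lra.
have pow k : circle_norm (u *+ (2 ^ k)%N) = circle_norm u *+ (2 ^ k)%N.
  elim: k => [|k IH]; first by rewrite !mulr1n.
  rewrite expnS mulnC !mulrnA -IH dbl//; exact: (small (2 ^ k)%N).
apply/eqP; rewrite eq_le circle_norm_ge0 andbT leNgt; apply/negP => u0.
pose k := (Num.trunc (circle_norm u)^-1).+1.
have uk : 1 < circle_norm u *+ k.
  have : (circle_norm u)^-1 < k%:R by exact: truncnS_gt.
  by rewrite -[circle_norm u *+ _]mulr_natl -ltr_pdivrMr// div1r.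
have := small (2 ^ k)%N; rewrite -pmulrn pow.
have : circle_norm u *+ k <= circle_norm u *+ (2 ^ k)%N.
  by rewrite ler_pMn2l// ltnW// ltn_expl.
move=> /(lt_le_trans uk) pow1 /(lt_trans pow1); by rewrite ltNge le4.
Qed.

Lemma continuous_circle_norm : continuous (@circle_norm R).
Proof.
apply/quotient_continuous => x; apply/cvgrPdist_le => e e0.
near=> y; rewrite /= -[(\pi x)%qT]/(proj_circle x) -[(\pi y)%qT]/(proj_circle y).
have dist_le s t : circle_norm (proj_circle s) - circle_norm (proj_circle t)
    <= `|s - t|.
  rewrite lerBlDl (le_trans _ (lerD (lexx _) (circle_norm_proj_le (s - t))))//.
  by rewrite (le_trans _ (circle_normD _ _))// -proj_circleD addrC subrK.
have xy : `|x - y| <= e by near: y; exact: cvgr_dist_le.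
rewrite ler_norml !(le_trans _ xy) ?dist_le//.
by rewrite andbT lerNl opprB (le_trans (dist_le _ _))// distrC.
Unshelve. all: by end_near. Qed.

Lemma continuous_circleMz (n : int) : continuous (fun u => u *~ n : circle R).
Proof.
apply/quotient_continuous.
rewrite (_ : _ \o _ = proj_circle \o (fun x => x * n%:~R)); last first.
  by apply/funext => x /=; rewrite mulrzr proj_circleMz.
move=> x; apply: continuous_comp; last exact: continuous_proj_circle.
exact: mulrr_continuous.
Qed.

Lemma continuous_circle_normMz (n : int) :
  continuous (fun u : circle R => circle_norm (u *~ n)).
Proof.
move=> u; apply: (@continuous_comp _ _ _ (fun v => v *~ n : circle R)).
  exact: continuous_circleMz.
exact: continuous_circle_norm.
Qed.

Lemma circle_compact : compact [set: circle R].
Proof.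
have -> : [set: circle R] = proj_circle @` `[0, 1]%classic.
  apply/seteqP; split=> // u _.
  exists (repr u - (Num.floor (repr u))%:~R).
    by rewrite /= in_itv /=; have := floor_itv (repr u); rewrite intrD; lra.
  rewrite -[RHS]proj_circle_repr; apply/proj_circle_eqP.
  by exists (- Num.floor (repr u)); rewrite mulrNz.
apply: continuous_compact; last exact: segment_compact.
exact/continuous_subspaceT/continuous_proj_circle.
Qed.

End CircleNorm.

(** * Bohr sets *)

Section BohrSets.
Variable R : realType.
Implicit Types (u v w : circle R) (s : seq (circle R)).

Lemma circle_coloring (delta : R) : 0 < delta ->
  exists (F : finType) (c : circle R -> F),
    forall u v, c u = c v -> circle_norm (u - v) < delta.
Proof.
move=> delta0; pose q := (Num.trunc delta^-1).+1.
have qV : (q%:R)^-1 < delta.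
  by rewrite -[ltRHS]invrK ltf_pV2 ?posrE ?invr_gt0// truncnS_gt.
pose x u : R := repr u - (Num.floor (repr u))%:~R.
have xE u : proj_circle (x u) = u.
  rewrite -[RHS]proj_circle_repr; apply/proj_circle_eqP.
  by exists (- Num.floor (repr u)); rewrite mulrNz.
have x01 u : 0 <= x u < 1.
  by have := floor_itv (repr u); rewrite /x intrD; lra.
have tr u : (Num.trunc (q%:R * x u))%:R <= q%:R * x u
    < (Num.trunc (q%:R * x u)).+1%:R.
  by apply: truncn_itv; rewrite mulr_ge0//; have /andP[] := x01 u.
have trq u : (Num.trunc (q%:R * x u) < q)%N.
  have /andP[trl _] := tr u; have /andP[_ x1] := x01 u.
  rewrite -(ltr_nat R) (le_lt_trans trl)// -[ltRHS]mulr1 ltr_pM2l//.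
exists 'I_q, (fun u => Ordinal (trq u)) => u v /(congr1 val)/= uv.
rewrite -[u]xE -[v]xE -proj_circleB (le_lt_trans (circle_norm_proj_le _))//.
rewrite (lt_trans _ qV)// -[ltRHS]mul1r ltr_pdivlMr//.
rewrite -[X in _ * X]ger0_norm// -normrM mulrC mulrBr.
have := tr u; have := tr v; rewrite uv -natr1 => /andP[v1 v2] /andP[u1 u2].
rewrite ltr_norml; apply/andP; split.
- by rewrite ltrBrDl (lt_le_trans _ u1)// ltrBlDr.
- by rewrite ltrBlDr (lt_le_trans u2)// addrC lerD2l.
Qed.

(** Total boundedness of a finite-dimensional torus, put as a coloring of the
points of [X] so that pigeonhole arguments apply to it directly. *)
Lemma circle_family_coloring (I : finType) (X : Type) (g : X -> I -> circle R)
    (delta : R) : 0 < delta ->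
  exists (F : finType) (c : X -> F),
    forall x y, c x = c y -> forall i, circle_norm (g x i - g y i) < delta.
Proof.
move=> /circle_coloring[F [c cP]].
exists {ffun I -> F}, (fun x => [ffun i => c (g x i)]) => x y /ffunP cxy i.
by apply: cP; have := cxy i; rewrite !ffunE.
Qed.

Definition bohr_set s (delta : R) : set int :=
  [set n | forall u, u \in s -> circle_norm (u *~ n) < delta].

(** Choosing one integer in each occupied color class of the orbit
[n |-> (u *~ n)_(u in s)] bounds the distance of any integer to a translate of
the Bohr set. *)
Lemma bohr_set_syndetic s (delta : R) : 0 < delta ->
  exists M : nat, forall n : int, exists r : int,
    (`|r| <= M)%N /\ bohr_set s delta (n - r).
Proof.
move=> delta0.
have [F [c cP]] := circle_family_coloring
  (fun (n : int) (i : 'I_(size s)) => s`_i *~ n) delta0.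
pose rep f : int := xget 0 [set n | c n = f].
exists (\max_(f : F) `|rep f|)%N => n; exists (rep (c n)).
split; first exact: (@leq_bigmax _ (fun f => `|rep f|%N) (c n)).
have repE : c n = c (rep (c n)) 
  by symmetry; apply: (xgetPex 0 (P := [set m | c m = c n])); exists n.
move=> u us; have i_lt : (index u s < size s)%N by rewrite index_mem.
by have := cP _ _ repE (Ordinal i_lt); rewrite /= nth_index// -mulrzBr.
Qed.

Lemma finite_set_int_bounded (E : set int) : finite_set E ->
  exists B : nat, forall n, E n -> (`|n| <= B)%N.
Proof.
move=> /finite_seqP[t ->]; exists (\max_(n <- t) `|n|)%N => n nt.
exact: (leq_bigmax_seq n nt isT).
Qed.

(** Because a Bohr set meets every interval of some fixed length, each of its
translates meets the long intervals in the range of a thick sequence, even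
away from a finite set. *)
Lemma thick_meets_bohr_set (a : nat -> int) s (delta : R) (E : set int)
    (n : int) : thick a -> 0 < delta -> finite_set E ->
  exists m : int, [/\ bohr_set s delta m, range a (n + m) & ~ E (n + m)].
Proof.
move=> a_thick /(bohr_set_syndetic s)[M MP] /finite_set_int_bounded[B EB].
have [p pP] := a_thick (2 * B + 4 * M + 6)%N.
(* An interval this long has a point at distance more than [B] from [0] whose
   [M]-neighbourhood stays in the interval and away from [-B, B]. *)
have [k [pk kp kB]] : exists k : int, [/\ p + M%:Z <= k,
    k <= p + (2 * B + 3 * M + 5)%:Z
  & forall r : int, (`|r| <= M)%N -> (B < `|(k - r)%R|)%N].
  have [pB|Bp] := leP (p + (2 * M)%:Z) (- B%:Z - 1).
    by exists (p + M%:Z); split=> [||r]; lia.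
  by exists (p + (2 * B + 3 * M + 5)%:Z); split=> [||r]; lia.
have [r [rM rP]] := MP (k - n).
exists (k - n - r); split=> //; have -> : n + (k - n - r) = k - r by lia.
- have -> : k - r = p + `|(k - r - p)%R|%N%:Z by lia.
  by apply: pP; lia.
- by move=> /EB; have := kB r rM; lia.
Qed.

(** For two members with close values at the finitely many representatives of the
translates of that Bohr set, all multiples of the difference are small, so the
two members coincide; finitely many colors decide that closeness. *)
Lemma finite_of_small_on_bohr_set s (delta : R) (K : set (circle R)) :
    0 < delta ->
    (forall n v, bohr_set s delta n -> K v -> circle_norm (v *~ n) < 16^-1) ->
  finite_set K.
Proof.
move=> delta0 small; have [M MP] := bohr_set_syndetic s delta0.
have e16 : 0 < 16^-1 :> R by rewrite invr_gt0.
have [F [c cP]] := circle_family_coloring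
  (fun u (i : 'I_(2 * M).+1) => u *~ (i%:Z - M%:Z)) e16.
suff cinj : {in K &, injective c}.
  by rewrite -(eq_finite_set (inj_card_eq cinj)); exact: finite_finset.
move=> u v /set_mem Ku /set_mem Kv cuv.
rewrite -[u](subrK v) -[RHS]add0r; congr (_ + _).
apply: circle_no_small_subgroup => n.
have [r [rM rP]] := MP n.
have i_lt : (`|(r + M%:Z)%R| < (2 * M).+1)%N by lia.
have := cP _ _ cuv (Ordinal i_lt); rewrite /= -mulrzBl.
have -> : `|(r + M%:Z)%R|%N%:Z - M%:Z = r by lia.
have := small _ _ rP Ku; have := small _ _ rP Kv => vs us rs.
rewrite -[n](subrK r) mulrzDr (le_lt_trans (circle_normD _ _))//.
rewrite [in X in X + _]mulrzBl; have := circle_normB (u *~ (n - r)) (v *~ (n - r)).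
lra.
Qed.

(** Translate [n] into the range of [a] by an element of the smaller Bohr set at
which [v] is small as well; halving [delta] and doubling [eps] pays for the
translation. *)
Lemma small_on_thick_bohr_set (a : nat -> int) s v (delta eps : R) (E : set int)
    (n : int) : thick a -> 0 < delta -> 0 < eps -> finite_set E ->
    (forall m, range a m -> ~ E m -> bohr_set s delta m ->
       circle_norm (v *~ m) < eps) ->
  bohr_set s (delta / 2) n -> circle_norm (v *~ n) < eps *+ 2.
Proof.
move=> a_thick delta0 eps0 finE small nB.
have d0 : 0 < Num.min (delta / 2) eps by rewrite lt_min eps0 divr_gt0.
have [m [mB am Em]] := thick_meets_bohr_set (v :: s) n a_thick d0 finE.
have mv : circle_norm (v *~ m) < eps.
  by have := mB v (mem_head _ _); rewrite lt_min => /andP[].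
have nm : circle_norm (v *~ (n + m)) < eps.
  apply: small => // u us; rewrite mulrzDr (le_lt_trans (circle_normD _ _))//.
  rewrite [delta]splitr ltrD ?nB//.
  have := mB u; rewrite in_cons us orbT => /(_ isT).
  by rewrite lt_min => /andP[].
rewrite -[n](addrK m) mulrzBr (le_lt_trans (circle_normB _ _))//.
by rewrite mulr2n ltrD.
Qed.

End BohrSets.

(** * The ideals and the P-ideal property *)

Section Ideals.
Variable R : realType.
Implicit Types (a : nat -> int) (H : set (circle R)).

(** The normal form of a generator of the ideal. A single [k] bounds the finite
exceptional set, counts the characters and controls [eps]: enlarging all three
at once only enlarges the cover, so countable unions over [k] suffice later. *)
Definition norm_cover (k : nat) (alpha : nat -> circle R) : set int :=
  [set n | (`|n| <= k)%N \/
    exists2 i, (i < k)%N & k.+1%:R^-1 <= circle_norm (alpha i *~ n)].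

Lemma norm_cover_mono k k' alpha alpha' : (k <= k')%N ->
    (forall i, (i < k)%N -> alpha' i = alpha i) ->
  norm_cover k alpha `<=` norm_cover k' alpha'.
Proof.
move=> kk' eqa n [nk|[i ik norm_i]]; first by left; exact: leq_trans kk'.
right; exists i; first exact: leq_trans kk'.
by rewrite eqa// (le_trans _ norm_i)// lef_pV2 ?posrE// ler_nat.
Qed.

Lemma subgroup0 H : is_subgroup H -> H 0.
Proof. by case; rewrite inE. Qed.

Lemma subgroupMz H u (n : int) : is_subgroup H -> H u -> H (u *~ n).
Proof.
move=> subgH Hu; have HB v w : H v -> H w -> H (v - w).
  by case: subgH => _ B Hv Hw; apply/set_mem/B; exact: mem_set.
have HN : H (- u) by rewrite -sub0r; apply: HB => //; exact: subgroup0.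
elim/int_ind: n => [|n IH|n IH]; first by rewrite mulr0z; exact: subgroup0.
- by rewrite -addn1 PoszD mulrzDr mulr1z -[u in X in _ + X]opprK; exact: HB.
- by rewrite -addn1 PoszD opprD mulrzDr mulrN1z; exact: HB.
Qed.

Lemma pos_lower_bound (s : seq (circle R * R)) :
    (forall p, p \in s -> 0 < p.2) ->
  exists2 delta : R, 0 < delta & forall p, p \in s -> delta <= p.2.
Proof.
elim: s => [|p s IH] pos; first by exists 1.
have [|delta delta0 le] := IH.
  by move=> q qs; apply: pos; rewrite in_cons qs orbT.
exists (Num.min p.2 delta); first by rewrite lt_min delta0 pos// mem_head.
move=> q; rewrite in_cons ge_min => /predU1P[->|/le ->]; first by rewrite lexx.
by rewrite orbT.
Qed.

Lemma finite_int_ball (k : nat) : finite_set [set n : int | (`|n| <= k)%N].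
Proof.
apply: (@sub_finite_set _ _ ((fun i : nat => i%:Z - k%:Z) @` `I_(2 * k).+1)).
  by move=> n /= nk; exists `|(n + k%:Z)%R|%N => /=; lia.
exact/finite_image/finite_II.
Qed.

Lemma idealIP a H S : H 0 ->
  idealI H a S <->
  S `<=` range a /\
  exists k alpha, (forall i, H (alpha i)) /\ S `<=` norm_cover k alpha.
Proof.
move=> H0; split=> [[Sa [E [s [finE _ sH ES]]]]|[Sa [k [alpha [Ha Sk]]]]];
  split=> //.
- have [|delta delta0 le] := @pos_lower_bound s; first by move=> p /sH[].
  have [B EB] := finite_set_int_bounded finE.
  pose k := (B + size s + Num.trunc delta^-1)%N.
  have kV : k.+1%:R^-1 <= delta.
    rewrite -[leRHS]invrK lef_pV2 ?posrE ?invr_gt0//.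
    by rewrite (le_trans (ltW (truncnS_gt _)))// ler_nat ltnS leq_addl.
  exists k, (fun i => (nth (0, 1) s i).1); split=> [i|n Sn].
    have [i_lt|i_ge] := ltnP i (size s); last by rewrite nth_default.
    by have [] := sH _ (mem_nth (0, 1) i_lt).
  have [/EB nB|[p /= ps [_ pn]]] := ES n Sn; first by left; rewrite /k; lia.
  right; exists (index p s).
    have : (index p s < size s)%N by rewrite index_mem.
    by rewrite /k; lia.
  by rewrite nth_index// (le_trans _ pn)// (le_trans kV)// le.
- exists (range a `&` [set n : int | (`|n| <= k)%N]).
  exists [seq (alpha i, k.+1%:R^-1) | i <- iota 0 k]; split.
  + exact/finite_setIr/finite_int_ball.
  + exact: subIsetl.
  + by move=> p /mapP[i _ ->] /=; rewrite invr_gt0.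
  + move=> n Sn; have an := Sa n Sn.
    have [nk|[i ik norm_i]] := Sk n Sn; [by left|right].
    exists (alpha i, k.+1%:R^-1) => //=.
    by apply/mapP; exists i => //; rewrite mem_iota.
Qed.

Lemma idealI_ideal a H : thick a -> H 0 -> is_ideal (range a) (idealI H a).
Proof.
move=> a_thick H0; split.
- by move=> S [].
- move=> S Sa finS; split=> //; exists S, [::]; split=> // n Sn; left.
- move=> S S' SS' [Sa [E [s [finE Ea sH S'E]]]]; split.
    exact: subset_trans Sa.
  by exists E, s; split=> //; exact: subset_trans S'E.
- move=> S S' [Sa [E [s [finE Ea sH SE]]]] [S'a [E' [s' [finE' E'a s'H S'E']]]].
  split; first by move=> n [/Sa|/S'a].
  exists (E `|` E'), (s ++ s'); split.
  + by rewrite finite_setU.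
  + by move=> n [/Ea|/E'a].
  + by move=> p; rewrite mem_cat => /orP[/sH|/s'H].
  + move=> n [/SE[En|[p ps pn]]|/S'E'[E'n|[p ps pn]]].
    * by left; left.
    * by right; exists p => //=; rewrite mem_cat ps.
    * by left; right.
    * by right; exists p => //=; rewrite mem_cat ps orbT.
- move=> /(idealIP _ _ H0)[_ [k [alpha [_ cover]]]].
  have d0 : 0 < k.+1%:R^-1 :> R by rewrite invr_gt0.
  have [m []] := thick_meets_bohr_set [seq alpha i | i <- iota 0 k] 0 a_thick d0
    (finite_int_ball k).
  rewrite add0r => mB /cover[//|[i ik]].
  by rewrite leNgt mB// map_f// mem_iota.
Qed.

Lemma preimage_ideal (U V : Type) (f : U -> V) (I : set (set V)) :
  is_ideal (range f) I -> is_ideal [set: U] [set S | I (f @` S)].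
Proof.
case=> subI finI downI cupI properI; split=> //=.
- by move=> S _ finS; apply: finI; [exact: image_subset|exact: finite_image].
- by move=> S S' SS'; apply: downI; exact: image_subset.
- by move=> S S' IS IS'; rewrite image_setU; exact: cupI.
Qed.

Lemma idealJ_ideal a H : thick a -> H 0 -> is_ideal [set: nat] (idealJ H a).
Proof. by move=> a_thick H0; exact/preimage_ideal/idealI_ideal. Qed.

(** The almost largest member consists of the [n] in the range that do not
annihilate [H]. It lies in the ideal because the nonzero norms of elements of
the finite subgroup [H] have a positive lower bound, [delta] below. *)
Lemma finite_subgroup_almost_max a H : is_subgroup H -> finite_set H ->
  exists2 S, idealI H a S &
    forall S', idealI H a S' -> finite_set (S' `\` S).
Proof.
move=> subgH /finite_seqP[h HE].
have H0 := subgroup0 subgH.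
pose s := [seq (u, circle_norm u) | u <- h & 0 < circle_norm u].
have [|delta delta0 le] := @pos_lower_bound s.
  by move=> p /mapP[u]; rewrite mem_filter => /andP[u0 _] ->.
have lower u : H u -> 0 < circle_norm u -> delta <= circle_norm u.
  rewrite HE => /= uh u0; apply: (le (u, circle_norm u)).
  by apply/mapP; exists u => //; rewrite mem_filter u0.
exists (range a `&` [set n | exists2 u, H u & delta <= circle_norm (u *~ n)]).
  split; first exact: subIsetl.
  exists set0, [seq (u, delta) | u <- h]; split=> //.
    by move=> p /mapP[u uh ->]; rewrite HE.
  move=> n [an [u Hu un]]; right; exists (u, delta) => //=.
  by apply/mapP; exists u => //; rewrite HE in Hu.
move=> S' [S'a [E [s' [finE _ s'H S'E]]]]; apply: sub_finite_set finE.
move=> n [/[dup] /S'a an /S'E[//|[p /= /s'H[Hp p0] [_ pn]]]] [].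
split=> //; exists p.1 => //; apply: lower; first exact: subgroupMz.
exact: lt_le_trans pn.
Qed.

Lemma finite_P_ideal (U : Type) (X : set U) (I : set (set U)) (S : set U) :
  is_ideal X I -> I S -> (forall S', I S' -> finite_set (S' `\` S)) ->
  P_ideal X I.
Proof. by move=> idI IS maxS; split=> // S_ IS_; exists S => // n; exact: maxS. Qed.

(** For an infinite [H], choose distinct [v j] in [H]. If one member of the ideal
almost contained every [Nset a (v j) 32^-1], all the characters [v j] would be
small on one common Bohr set, so they would form a finite set. *)
Lemma P_ideal_finite a H : thick a -> H 0 ->
  P_ideal (range a) (idealI H a) -> finite_set H.
Proof.
move=> a_thick H0 [_ Pid]; apply: contrapT => /infiniteP/pcard_leP/unsquash v.
have Hv k : H (v k) by exact: funS.
have e32 : 0 < 32^-1 :> R by rewrite invr_gt0.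
have [k|S /(idealIP _ _ H0)[_ [k [alpha [_ cover]]]] almost] :=
    Pid (fun k => Nset a (v k) 32^-1).
  split; first by move=> n [].
  exists set0, [:: (v k, 32^-1)]; split=> //.
    by move=> p; rewrite mem_seq1 => /eqP -> /=; split; [exact: Hv|].
  by move=> n nv; right; exists (v k, 32^-1) => //=; rewrite mem_seq1.
have d0 : 0 < k.+1%:R^-1 :> R by rewrite invr_gt0.
apply: infinite_nat.
have v_inj : {in [set: nat] &, injective v}.
  by move=> i j _ _; apply: (@inj _ _ _ v); rewrite inE.
rewrite -(eq_finite_set (inj_card_eq v_inj)).
apply: (@finite_of_small_on_bohr_set _
  [seq alpha i | i <- iota 0 k] (k.+1%:R^-1 / 2)).
  by rewrite divr_gt0.
move=> n _ nB [j _ <-].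
have -> : 16^-1 = 32^-1 *+ 2 :> R by rewrite mulr2n; lra.
have finE : finite_set ((Nset a (v j) 32^-1 `\` S) `|` [set m | (`|m| <= k)%N]).
  by rewrite finite_setU; split; [exact: almost|exact: finite_int_ball].
apply: (small_on_thick_bohr_set a_thick d0 e32 finE _ nB) => m am.
move=> /not_orP[notD mk] mB; rewrite ltNge; apply/negP => vm.
apply: notD; split=> // /cover[//|[i ik]].
by rewrite leNgt mB// map_f// mem_iota.
Qed.

(** Take preimages, find an almost union of them, and push it forward: [f] maps
the finite differences to finite sets. *)
Lemma image_P_ideal (U V : Type) (f : U -> V) (I : set (set V)) :
    is_ideal (range f) I -> P_ideal [set: U] [set S | I (f @` S)] ->
  P_ideal (range f) I.
Proof.
move=> idI [_ Pid]; split=> // S_ IS_; have [subI _ downI _ _] := idI.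
have [n|S IS almost] := Pid (fun n => f @^-1` S_ n).
  by apply: downI (IS_ n); exact: image_preimage_subset.
exists (f @` S) => // n; apply: sub_finite_set (finite_image f (almost n)).
move=> y [Sy notSy]; have [x _ xy] := subI _ (IS_ n) y Sy.
by exists x => //; split; [rewrite /= xy|move=> Sx; apply: notSy; exists x].
Qed.

Lemma idealI_P_idealP a H : thick a -> is_subgroup H ->
  finite_set H <-> P_ideal (range a) (idealI H a).
Proof.
move=> a_thick subgH; have H0 := subgroup0 subgH; split; last exact: P_ideal_finite.
move=> /(finite_subgroup_almost_max a subgH)[S IS maxS].
exact: finite_P_ideal (idealI_ideal a_thick H0) IS maxS.
Qed.

Lemma idealJ_P_idealP a H : thick a -> is_subgroup H -> finite_to_one a ->
  finite_set H <-> P_ideal [set: nat] (idealJ H a).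
Proof.
move=> a_thick subgH a_fin; have H0 := subgroup0 subgH; split; last first.
  by move=> /(image_P_ideal (idealI_ideal a_thick H0)); exact: P_ideal_finite.
move=> /(finite_subgroup_almost_max a subgH)[S IS maxS].
have idI := idealI_ideal a_thick H0; have [_ _ downI _ _] := idI.
apply: (finite_P_ideal (S := a @^-1` S)) => [||S' /maxS finS'].
- exact: idealJ_ideal.
- by apply: downI IS; exact: image_preimage_subset.
- apply: (@sub_finite_set _ _ (\bigcup_(n in a @` S' `\` S) a @^-1` [set n])).
    by move=> i [S'i notS]; exists (a i) => //; split=> //; exists i.
  by apply: bigcup_finite => // n _; exact: a_fin.
Qed.

End Ideals.

(** * Spaces of sequences in a discrete space *)

Section Cylinders.
Variable T : discreteTopologicalType.
Local Notation seqT := (prod_topology (fun _ : nat => T)).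

Definition cylinder (y : nat -> T) (m : nat) : set seqT :=
  [set z | forall i, (i < m)%N -> z i = y i].

Lemma nbhs_coordinate (y : seqT) (i : nat) : \forall z \near y, z i = y i.
Proof.
exact: (@proj_continuous nat (fun=> T) i y [set y i] (discrete_set1 _)).
Qed.

Lemma nbhs_cylinderP (y : seqT) (U : set seqT) :
  nbhs y U <-> exists m, cylinder y m `<=` U.
Proof.
split=> [|[m mU]]; last first.
  apply: filterS mU _; elim: m => [|m IH]; first by apply: filterS filterT => z _ i.
  apply: filterS2 _ IH (nbhs_coordinate y m) => z zm ym i.
  by rewrite ltnS leq_eqVlt => /predU1P[->|/zm].
pose C : set_system seqT := filter_from [set: nat] (cylinder y).
have FC : Filter C.
  apply: filter_from_filter; first by exists 0%N.
  move=> m n _ _; exists (maxn m n) => // z zmn.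
  by split=> i im; apply: zmn; rewrite leq_max im ?orbT.
suff Cy : C --> y by move=> /Cy[m _ mU]; exists m.
apply/cvg_sup => i U' [] P [] [] V oV <- Vy PU'; exists i.+1 => // z zi.
by apply: PU'; rewrite /= zi.
Qed.

Lemma continuous_seqP (S : topologicalType) (g : S -> seqT) :
  (forall n x, \forall x' \near x, g x' n = g x n) -> continuous g.
Proof.
move=> gn x U /nbhs_cylinderP[m mU].
suff : nbhs x (g @^-1` cylinder (g x) m) by apply: filterS => z /mU.
elim: m {mU} => [|m IH]; first by apply: filterS filterT => z _ i.
apply: filterS2 _ IH (gn m x) => z zm gzm i.
by rewrite ltnS leq_eqVlt => /predU1P[->|/zm].
Qed.

(** The least cylinder around [y] that lies on one side decides the value at
[y], and every point of that cylinder has the same least cylinder. *)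
Lemma seq_space_separation (R : realType) (g : seqT -> R) (lo hi : R) :
    lo < hi -> continuous g ->
  exists h : seqT -> bool,
    [/\ forall y, \forall z \near y, h z = h y,
        forall y, hi <= g y -> h y
      & forall y, h y -> lo < g y].
Proof.
move=> lohi cg.
pose above (y : seqT) m := forall z, cylinder y m z -> lo < g z.
pose below (y : seqT) m := forall z, cylinder y m z -> g z < hi.
have decided y : exists m, `[< above y m \/ below y m >].
  have [lt|ge] := ltP (g y) hi.
  - have /nbhs_cylinderP[m mP] : \forall z \near y, g z < hi.
      exact: (cvgr_lt (g y) (cg y)).
    by exists m; apply/asboolP; right.
  - have /nbhs_cylinderP[m mP] : \forall z \near y, lo < g z.
      by apply: (cvgr_gt (g y) (cg y)); exact: lt_le_trans ge.
    by exists m; apply/asboolP; left.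
pose h y := `[< above y (ex_minn (decided y)) >].
have selfcyl y m : cylinder y m y by [].
have cylE y z m : cylinder y m z -> cylinder z m = cylinder y m.
  by move=> yz; apply/seteqP; split=> x xm i im; rewrite xm// yz.
exists h; split=> [y|y hiy|y /asboolP]; last exact.
- apply/nbhs_cylinderP; rewrite /h; case: ex_minnP => m my mmin.
  exists m => z zm; case: ex_minnP => m' mz m'min.
  have eqP_le k : (k <= m)%N ->
      (above z k = above y k) * (below z k = below y k).
    move=> km; have zk : cylinder y k z.
      by move=> i ik; apply: zm; exact: leq_trans km.
    by rewrite /above /below (cylE _ _ _ zk).
  have m'm : (m' <= m)%N by apply: m'min; rewrite !eqP_le.
  have mm' : (m <= m')%N by apply: mmin; rewrite -!(eqP_le m').
  have -> : m' = m by apply/eqP; rewrite eqn_leq m'm.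
  by rewrite eqP_le.
- apply/asboolP; case: ex_minnP => m /asboolP[//|bel] _.
  by have := bel y (selfcyl y m); rewrite ltNge hiy.
Qed.

End Cylinders.

(** * Topological complexity of the ideal *)

Section Complexity.
Variable R : realType.
Implicit Types (a : nat -> int) (H K : set (circle R)).

Definition covered_subsets a k K : set cantor_space :=
  [set x | exists2 alpha : nat -> circle R, forall i, (i < k)%N -> K (alpha i)
    & forall n, x n -> norm_cover k alpha (a n)].

Lemma in_cantor_idealJ a H : H 0 ->
  in_cantor (idealJ H a) = \bigcup_k covered_subsets a k H.
Proof.
move=> H0; apply/seteqP; split=> x.
  move=> /(idealIP _ _ H0)[_ [k [alpha [Ha cover]]]].
  by exists k => //; exists alpha => // n xn; apply: cover; exists n.
move=> [k _ [alpha Ha cover]]; apply/(idealIP _ _ H0); split.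
  by move=> _ [n _ <-]; exists n.
exists k, (fun i => if (i < k)%N then alpha i else 0).
split=> [i|_ [n xn <-]]; first by case: ltnP => // /Ha.
by apply: norm_cover_mono (cover n xn) => // i ->.
Qed.

(** The admissible pairs of a tuple of characters and a subset form a closed
subset of a compact product, of which this is a projection. *)
Lemma covered_subsets_closed a k K : closed K -> closed (covered_subsets a k K).
Proof.
move=> clK.
pose circles : topologicalType := prod_topology (fun _ : nat => circle R).
pose tuples : set circles :=
  [set alpha | forall i, (if (i < k)%N then K else setT) (alpha i)].
pose graph : set (circles * cantor_space) :=
  [set p : circles * cantor_space | forall n, p.2 n -> norm_cover k p.1 (a n)].
have -> : covered_subsets a k K = snd @` ((tuples `*` setT) `&` graph).
  apply/seteqP; split=> [x [alpha Ka cover]|_ [[alpha x] [[/= ta _] cover] <-]].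
    by exists (alpha, x) => //; split=> //; split=> // i /=; case: ltnP => // /Ka.
  by exists alpha => // i ik; have := ta i; rewrite ik.
apply: compact_closed; first exact: cantor_space_hausdorff.
apply: continuous_compact.
  by apply: continuous_subspaceT => p; exact: cvg_snd.
apply: compact_closedI.
  apply: compact_setX; last exact: cantor_space_compact.
  apply: (@tychonoff nat (fun=> circle R)
    (fun i => if (i < k)%N then K else setT)) => i.
  case: ifP => _; last exact: circle_compact.
  exact: (subclosed_compact clK (@circle_compact R)).
have -> : graph = \bigcap_n [set p : circles * cantor_space |
    p.2 n -> norm_cover k p.1 (a n)].
  by apply/seteqP; split=> p pP n; [move=> _|]; exact: pP.
apply: closed_bigI => n _.
have [an|an] := boolP (`|a n| <= k)%N.
  rewrite (_ : [set p : circles * cantor_space | _] = setT)//.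
  by apply/seteqP; split=> // p _ _; left.
rewrite (_ : [set p : circles * cantor_space | _] =
    [set p : circles * cantor_space | p.2 n = false] `|`
    \bigcup_(i in `I_k) [set p : circles * cantor_space |
      k.+1%:R^-1 <= circle_norm (p.1 i *~ a n)]); last first.
  apply/seteqP; split=> p /=.
    case: (p.2 n); last by left.
    by move=> /(_ isT)[|[i ik ?]]; [rewrite (negbTE an)|right; exists i].
  by move=> [->//|[i ik ?] _]; right; exists i.
apply: closedU.
  apply: (@preimage_closed _ _
    (fun p : circles * cantor_space => p.2 n) [set false]).
    move=> p _; apply: (@continuous_comp _ _ _ snd (fun z : cantor_space => z n)).
      exact: cvg_snd.
    exact: (@proj_continuous nat (fun=> bool)).
  exact: discrete_closed.
apply: closed_bigcup => [|i _]; first exact: finite_II.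
apply: (@preimage_closed _ _
    (fun p : circles * cantor_space => circle_norm (p.1 i *~ a n))
    [set t | k.+1%:R^-1 <= t]); last exact: closed_ge.
move=> p _; apply: (@continuous_comp _ _ _
  (fun p : circles * cantor_space => p.1 i) (fun u => circle_norm (u *~ a n))).
  apply: (@continuous_comp _ _ _ fst (fun alpha : circles => alpha i)).
    exact: cvg_fst.
  exact: (@proj_continuous nat (fun=> circle R)).
exact: continuous_circle_normMz.
Qed.

(** Raising [k] makes room both for the indices of the closed pieces that
contain the finitely many characters in use and for the piece containing [0],
which pads the tuple. *)
Lemma in_cantor_idealJ_bigcup a H (C : nat -> set (circle R)) :
    H 0 -> H = \bigcup_j C j ->
  in_cantor (idealJ H a) =
  \bigcup_k covered_subsets a k (\bigcup_(j in `I_k) C j).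
Proof.
move=> H0 HC; rewrite in_cantor_idealJ//.
apply/seteqP; split=> x [k _ [alpha Ka cover]]; last first.
  exists k => //; exists alpha => // i /Ka[j _ Cj].
  by rewrite HC; exists j.
pose beta i := if (i < k)%N then alpha i else 0.
have /choice[j jP] i : exists j, C j (beta i).
  have : H (beta i) by rewrite /beta; case: ltnP => // /Ka.
  by rewrite HC => -[j _ Cj]; exists j.
pose k' := (k + j k + \max_(i < k) j i).+1.
exists k' => //; exists beta.
  move=> i _; have [ik|ki] := ltnP i k.
    exists (j i) => //=; rewrite /k' ltnS.
    apply: leq_trans (leq_addl _ _).
    exact: (leq_bigmax (F := fun i : 'I_k => j i) (Ordinal ik)).
  exists (j k); first by rewrite /= /k'; lia.
  by have := jP k; rewrite /beta ltnn ltnNge ki.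
move=> n /cover; apply: norm_cover_mono; first by rewrite /k'; lia.
by move=> i ik; rewrite /beta ik.
Qed.

Lemma Fsigma_idealJ a H : H 0 -> Fsigma H -> Fsigma (in_cantor (idealJ H a)).
Proof.
move=> H0 [C clC HC].
exists (fun k => covered_subsets a k (\bigcup_(j in `I_k) C j)).
  move=> k; apply: covered_subsets_closed; apply: closed_bigcup => [|//].
  exact: finite_II.
exact: in_cantor_idealJ_bigcup.
Qed.

(** A set outside the closed hereditary family [F n] has a finite part that is
outside too; the union of such parts of the [A_ n] is positive. *)
Lemma Pplus_of_closed_hereditary (J : set (set nat)) (F : nat -> set cantor_space) :
    is_ideal [set: nat] J -> (forall k, closed (F k)) ->
    (forall k (x y : cantor_space), (forall n, x n -> y n) -> F k y -> F k x) ->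
    in_cantor J = \bigcup_k F k ->
  Pplus_ideal [set: nat] J.
Proof.
move=> idJ clF hereF JF; split=> // A_ posA decA.
pose chi (A : set nat) : cantor_space := fun n => `[< A n >].
have JchiP A : J A <-> exists k, F k (chi A).
  have -> : J A <-> in_cantor J (chi A).
    rewrite /in_cantor /= (_ : [set n | chi A n] = A)//.
    by apply/seteqP; split=> n /asboolP.
  by rewrite JF; split=> [[k]|[k]] Fk; exists k.
have /choice[N NP] n : exists N, ~ F n (chi (A_ n `&` `I_N)).
  have [_ nJ] := posA n.
  have nF : (~` F n) (chi (A_ n)) by move=> Fn; apply: nJ; apply/JchiP; exists n.
  have /nbhs_cylinderP[m mF] : nbhs (chi (A_ n)) (~` F n).
    by apply: open_nbhs_nbhs; split=> //; rewrite openC.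
  exists m; apply: mF => i im; apply/asbool_equiv_eq.
  by split=> [[]|].
have decA' m n : (m <= n)%N -> A_ n `<=` A_ m.
  elim: n => [|n IH]; first by rewrite leqn0 => /eqP ->.
  rewrite leq_eqVlt => /predU1P[->//|mn]; exact: subset_trans (decA n) (IH mn).
exists (\bigcup_n (A_ n `&` `I_(N n))).
  split=> // /JchiP[k]; move=> Fk; apply: (NP k); apply: hereF Fk => i /asboolP Ai.
  by apply/asboolP; exists k.
move=> n; apply: (@sub_finite_set _ _ (\bigcup_(m in `I_n) (A_ m `&` `I_(N m)))).
  move=> i [[m _ [Ami iN]] nAi]; exists m => //=; rewrite ltnNge; apply/negP => nm.
  exact/nAi/decA'/Ami.
by apply: bigcup_finite => [|m _]; [exact: finite_II|exact/finite_setIr/finite_II].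
Qed.

Lemma Pplus_idealJ a H : thick a -> H 0 -> Fsigma H ->
  Pplus_ideal [set: nat] (idealJ H a).
Proof.
move=> a_thick H0 [C clC HC].
apply: Pplus_of_closed_hereditary (in_cantor_idealJ_bigcup a H0 HC).
- exact: idealJ_ideal.
- move=> k; apply: covered_subsets_closed; apply: closed_bigcup => [|//].
  exact: finite_II.
- by move=> k x y xy [alpha Ka cover]; exists alpha => // n /xy; exact: cover.
Qed.

(** A code lists [k], the subset from which the values are cut down, and the
codes of the characters. The closed conditions on the norms are replaced by
clopen ones that lie between the bounds for [k] and for [2k+1]; this keeps the
union over [k] and makes each coordinate of the coded set locally constant. *)
Lemma analytic_idealJ a H : H 0 -> analytic H ->
  analytic (in_cantor (idealJ H a)).
Proof.
move=> H0 [H_eq0|[f cf fH]]; first by rewrite H_eq0 in H0.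
right; rewrite in_cantor_idealJ//.
have sep (kn : nat * nat) : exists h : baire_space -> bool,
    [/\ forall y, \forall z \near y, h z = h y,
        forall y, kn.1.+1%:R^-1 <= circle_norm (f y *~ a kn.2) -> h y
      & forall y, h y -> (kn.1.*2.+2)%:R^-1 < circle_norm (f y *~ a kn.2)].
  apply: seq_space_separation.
    by rewrite ltf_pV2 ?posrE// ltr_nat; lia.
  move=> y; apply: (@continuous_comp _ _ _ f (fun u => circle_norm (u *~ a kn.2))).
    exact: cf.
  exact: continuous_circle_normMz.
have {sep}/choice[h hP] := sep.
pose code (c : option (nat + nat * nat)) : nat := pickle c.
pose kof (w : baire_space) : nat := w (code None).
pose subset_of (w : baire_space) n : bool := w (code (Some (inl n))) != 0%N.
pose char_of (w : baire_space) i : baire_space :=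
  fun m => w (code (Some (inr (i, m)))).
pose g (w : baire_space) : cantor_space := fun n => subset_of w n &&
  ((`|a n| <= kof w)%N || [exists i : 'I_(kof w), h (kof w, n) (char_of w i)]).
exists g.
- apply: continuous_seqP => n w.
  have near_h (l : nat) : \forall w' \near w, forall i, (i < l)%N ->
      h (kof w, n) (char_of w' i) = h (kof w, n) (char_of w i).
    elim: l => [|l IH]; first by apply: filterS filterT => w' _ i.
    have cl : continuous (fun w' : baire_space => char_of w' l).
      apply: continuous_seqP => m w'; exact: nbhs_coordinate.
    have [hloc _ _] := hP (kof w, n).
    apply: filterS2 _ IH (cl w _ (hloc (char_of w l))) => w' IH hl i.
    by rewrite ltnS leq_eqVlt => /predU1P[->|/IH].
  apply: filterS3 _ (nbhs_coordinate w (code None))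
    (nbhs_coordinate w (code (Some (inl n)))) (near_h (kof w)).
  move=> w' kE sE hE; rewrite /g /subset_of sE.
  have -> : kof w' = kof w by [].
  by congr (_ && (_ || _)); apply: eq_existsb => i; exact: hE.
- apply/seteqP; split=> [_ [w _ <-]|x [k _ [alpha Ha cover]]].
    exists (kof w).*2.+1 => //; exists (fun i => f (char_of w i)).
      by move=> i _; rewrite -fH; exists (char_of w i).
    move=> n /andP[_ /orP[nk|/existsP[i hi]]]; first by left; lia.
    have [_ _ hlo] := hP (kof w, n).
    right; exists i; first by have := ltn_ord i; lia.
    exact/ltW/hlo.
  have /choice[y yP] i : exists y, (i < k)%N -> f y = alpha i.
    have [ik|ki] := ltnP i k; last by exists (fun=> 0%N).
    by have := Ha i ik; rewrite -fH => -[y _ fy]; exists y.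
  pose w : baire_space := fun m => match unpickle m with
    | Some (Some (inl n)) => nat_of_bool (x n)
    | Some (Some (inr (i, m'))) => y i m'
    | _ => k
    end.
  have kE : kof w = k by rewrite /kof /w /code pickleK.
  have sE n : subset_of w n = x n.
    by rewrite /subset_of /w /code pickleK; case: (x n).
  have cE i : char_of w i = y i.
    by apply/funext => m; rewrite /char_of /w /code pickleK.
  exists w => //; apply/funext => n; rewrite /g sE kE.
  case xn : (x n) => //=; have [->//|[i ik norm_i]] := cover n xn.
  apply/orP; right; apply/existsP; exists (Ordinal ik); rewrite cE /=.
  by have [_ hhi _] := hP (k, n); apply: hhi; rewrite yP.
Qed.

End Complexity.

Theorem proposition2p13 (R : realType) (a : nat -> int) (H : set (circle R))
    (a_thick : thick a) (H_subgroup : is_subgroup H) :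
  [/\ Fsigma H ->
        [/\ is_ideal [set: nat] (idealJ H a),
            Fsigma (in_cantor (idealJ H a))
          & Pplus_ideal [set: nat] (idealJ H a)],
      analytic H ->
        is_ideal [set: nat] (idealJ H a) /\ analytic (in_cantor (idealJ H a)),
      finite_set H <-> P_ideal (range a) (idealI H a)
    & finite_to_one a ->
        (finite_set H <-> P_ideal [set: nat] (idealJ H a))].
Proof.
have H0 := subgroup0 H_subgroup; split.
- move=> FH; split; [exact: idealJ_ideal|exact: Fsigma_idealJ|].
  exact: Pplus_idealJ.
- by move=> aH; split; [exact: idealJ_ideal|exact: analytic_idealJ].
- exact: idealI_P_idealP.
- exact: idealJ_P_idealP.
Qed.
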